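(* Let $G$ be an $f$-equitable graph with quotient matrix $Q$ and valency $k$, where the range of the function $f$ is $\{x_0,x_1,\ldots,x_r\}$ and $Q$ is indexed in the order $x_0,x_1,\ldots,x_r$. Let $h_{x_0}=0$, and define $h_{x_1},\ldots,h_{x_r}$ by $$\vec H=(h_{x_1},h_{x_2},\ldots,h_{x_r})=-\vec{\mathbf 1}\left(\frac1k Q^- - I\right)^{-1},$$ where $Q^-$ is the submatrix obtained by removing the $x_0$th row and the $x_0$th column from $Q$, $\vec{\mathbf 1}$ is the all-one (row) vector and $I$ is the identity matrix. Then, for any vertices $u$ and $v$ in $G$, $$H(G;(v,u))=h_{f(v,u)}.$$
   Context: $N(v)$ denotes the neighbour set of a vertex $v$ in $G$. Hitting time: in a simple random walk on a graph, each step moves to a neighbour of the current vertex chosen with equal probability. The hitting time from $u$ to $v$ is the number of steps required to reach $v$ for the first time in a simple random walk starting from $u$. Its expected value, the average hitting time from $u$ to $v$, is denoted $H(G;(v,u))$, and $H(G;(v,v))=0$ by definition. Equitable partition: a partition $P=\{V_0,\ldots,V_r\}$ of the vertex set of $G$ is equitable if for all $0\le i,j\le r$ and all $u,v\in V_j$, $|N(u)\cap V_i|=|N(v)\cap V_i|$. Its quotient matrix is $(q_{ij})$ with $q_{ij}=|N(v)\cap V_i|$ for any $v\in V_j$. $f$-equitable graph: let $G$ be a graph with vertex set $V$ and let $f:V\times V\to\{x_0,x_1,\ldots,x_r\}$ be a function. For $o\in V$ let $F_{x_i}(o)=\{v\in V: f(o,v)=x_i\}$ and let $P_o=\{F_{x_0}(o),F_{x_1}(o),\ldots,F_{x_r}(o)\}$,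 a partition of $V$. $G$ is $f$-equitable if for every vertex $o$: (1) $F_{x_0}(o)=\{o\}$; (2) $P_o$ is equitable; (3) the quotient matrix of $P_o$, indexed by $x_0,x_1,\ldots,x_r$, does not depend on the choice of $o$. This common matrix is called the quotient matrix of the $f$-equitable graph. An $f$-equitable graph is regular, and its valency is the common degree of its vertices. *)

(* Defs.v *)
From HB Require Import structures.
From mathcomp Require Import all_boot all_order all_algebra.
From mathcomp Require Import all_classical all_reals all_analysis.

Set Implicit Arguments.
Unset Strict Implicit.
Unset Printing Implicit Defensive.

Import Order.TTheory GRing.Theory Num.Theory.
Import numFieldNormedType.Exports.

Local Open Scope classical_set_scope.
Local Open Scope ring_scope.

Section Graphs.
Variable V : finType.

Definition simple_graph (e : rel V) : Prop := symmetric e /\ irreflexive e.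

Definition connected_graph (e : rel V) : Prop := forall u v, connect e u v.

Definition nbrs (e : rel V) (v : V) : {set V} := [set w | e v w]%SET.

Definition regular_graph (e : rel V) (k : nat) : Prop :=
  forall v, #|nbrs e v| = k.

(* The cells are given as a family [C], so that the quotient matrix has a
   definite indexing; row i, column j counts the neighbours in [C i] of a
   vertex of [C j]. *)
Definition equitable (e : rel V) (n : nat) (C : 'I_n -> {set V}) : Prop :=
  forall i j u v, u \in C j -> v \in C j ->
    #|nbrs e u :&: C i| = #|nbrs e v :&: C i|.

Definition is_quotient_matrix (e : rel V) (n : nat) (C : 'I_n -> {set V})
    (Q : 'M[nat]_n) : Prop :=
  forall i j v, v \in C j -> Q i j = #|nbrs e v :&: C i|.

Variables (X : eqType) (r : nat).

Definition enumerates_range (f : V -> V -> X) (x : 'I_r.+1 -> X) : Prop :=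
  injective x /\ (forall y, (exists u v, f u v = y) <-> (exists i, x i = y)).

Definition cells (f : V -> V -> X) (x : 'I_r.+1 -> X) (o : V) (i : 'I_r.+1) :
  {set V} := [set v | f o v == x i]%SET.

Definition common_quotient_matrix (e : rel V) (f : V -> V -> X)
    (x : 'I_r.+1 -> X) (Q : 'M[nat]_r.+1) : Prop :=
  forall o, is_quotient_matrix e (cells f x o) Q.

Definition f_equitable (e : rel V) (f : V -> V -> X) (x : 'I_r.+1 -> X) :
    Prop :=
  [/\ forall o, cells f x o ord0 = [set o]%SET,
      forall o, equitable e (cells f x o)
    & exists Q, common_quotient_matrix e f x Q].

End Graphs.

Definition Qminus (R : realType) (r : nat) (Q : 'M[nat]_r.+1) : 'M[R]_r :=
  map_mx (fun n : nat => n%:R) (row' ord0 (col' ord0 Q)).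

Section RandomWalk.
Context {R : realType} {d : measure_display} {Omega : measurableType d}.
Variables (V : finType) (P : probability Omega R).

Definition follows (W : nat -> Omega -> V) (n : nat) (w : nat -> V) :
  set Omega := [set om | forall i, (i <= n)%N -> W i om = w i].

(* When w n has a neighbour, the last clause forces, by summation over the
   neighbours, the step from w n to be almost surely to a neighbour; it puts no
   constraint on the walk at an isolated vertex, where no step is possible. *)
Definition simple_random_walk (e : rel V) (W : nat -> Omega -> V) (u : V) :
    Prop :=
  [/\ forall n a, measurable [set om | W n om = a],
      P [set om | W 0%N om = u] = 1%E
    & forall n w b, e (w n) b ->
        P (follows W n w `&` [set om | W n.+1 om = b]) =
        (P (follows W n w) * (#|nbrs e (w n)|%:R^-1)%:E)%E].

(* +oo if the walk never visits v, and 0 if it starts at v. *)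
Definition hitting_time (W : nat -> Omega -> V) (v : V) (om : Omega) : \bar R :=
  ereal_inf [set (n%:R)%:E | n in [set n | W n om = v]].

Definition average_hitting_time (W : nat -> Omega -> V) (v : V) : \bar R :=
  (\int[P]_om hitting_time W v om)%E.

End RandomWalk.

(* Main.v *)
(* Equitability says that, for a target v, a function of the form
   a |-> y (f v a) has as neighbour sum at a <> v the entry, at the class of a,
   of the row vector y times Q. Hence a kernel vector of Q^-/k - I gives a
   function that vanishes at v and is harmonic elsewhere, so it is zero by the
   maximum principle; and g := h (f v _) satisfies g v = 0 and has mean g a - 1
   over the neighbours of a <> v. With T the hitting time of v, the quantity
   G_n = E[g (W_n); T > n] then satisfies G_(n+1) = G_n - P(T > n), so the
   partial sums of the series of P(T > n) are g u - G_n. As G_n is bounded, the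
   series converges, thus P(T > n), and with it G_n, tends to 0, and
   E[T] = sum of the P(T > n) = g u. *)

Require Import Defs.
From HB Require Import structures.
From mathcomp Require Import all_boot all_order all_algebra.
From mathcomp Require Import all_classical all_reals all_analysis.
From mathcomp Require Import measurable_realfun.

Set Implicit Arguments.
Unset Strict Implicit.
Unset Printing Implicit Defensive.

Import Order.TTheory GRing.Theory Num.Theory.
Import numFieldNormedType.Exports.

Local Open Scope classical_set_scope.
Local Open Scope ring_scope.

(** * Maximum principle on a connected regular graph *)

Section MaximumPrinciple.
Variables (R : realFieldType) (V : finType) (e : rel V) (k : nat).
Hypothesis e_connected : connected_graph e.
Hypothesis e_regular : regular_graph e k.

(** The differences [g a - g w] over the neighbours [w] of [a] are nonnegative, and they sum to zero
    because [g a] is the mean; so each one vanishes. *)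
Lemma harmonic_max (g : V -> R) (o a b : V) :
  (forall w, g w <= g a) -> a != o -> e a b ->
  k%:R^-1 * \sum_(w in nbrs e a) g w = g a -> g b = g a.
Proof.
move=> gmax ao eab.
have bin : b \in nbrs e a by rewrite inE.
have k0 : (k%:R : R) != 0.
  by rewrite pnatr_eq0 -lt0n -(e_regular a); apply/card_gt0P; exists b.
move=> /(canRL (mulVKf k0)) gs.
have s0 : \sum_(w in nbrs e a) (g a - g w) = 0.
  by rewrite sumrB sumr_const e_regular gs -[g a *+ k]mulr_natl subrr.
have /(_ _ bin) /eqP := psumr_eq0P (fun w _ => etrans (subr_ge0 _ _) (gmax w)) s0.
by rewrite subr_eq0 => /eqP.
Qed.

Lemma harmonic_le0 (g : V -> R) (o : V) :
  g o = 0 ->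
  (forall a, a != o -> k%:R^-1 * \sum_(w in nbrs e a) g w = g a) ->
  forall a, g a <= 0.
Proof.
move=> go gh a.
pose m := [arg max_(i > o) g i]%O.
have gmax w : g w <= g m by rewrite /m; case: arg_maxP => // i _; apply.
suff <- : g m = 0 by exact: gmax.
have [p] := connectP (e_connected m o).
(* The maximum is carried along a path from [m] until it meets [o], where [g] is zero; only the
   maximality of the current vertex is kept. *)
elim: p (m) gmax => [|c p IH] b bmax /=; first by move=> _ <-.
case/andP=> ebc pc lo.
have [->//|bo] := eqVneq b o.
have gcb := harmonic_max bmax bo ebc (gh _ bo).
by rewrite -gcb; apply: IH => // w; rewrite gcb.
Qed.

Lemma harmonic_eq0 (g : V -> R) (o : V) :
  g o = 0 ->
  (forall a, a != o -> k%:R^-1 * \sum_(w in nbrs e a) g w = g a) ->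
  forall a, g a = 0.
Proof.
move=> go gh a; apply/le_anti/andP; split; first exact: harmonic_le0 go gh a.
rewrite -oppr_le0; apply: (@harmonic_le0 (fun w => - g w) o).
  by rewrite go oppr0.
by move=> b bo; rewrite sumrN mulrN gh.
Qed.

End MaximumPrinciple.

(** * Neighbour sums and the quotient matrix *)

Section Quotient.
Variables (R : realType) (V : finType) (e : rel V) (X : eqType) (r : nat).
Variables (x : 'I_r.+1 -> X) (f : V -> V -> X) (Q : 'M[nat]_r.+1) (k : nat).
Hypothesis e_connected : connected_graph e.
Hypothesis f_range : enumerates_range f x.
Hypothesis e_equitable : f_equitable e f x.
Hypothesis Q_quotient : common_quotient_matrix e f x Q.
Hypothesis e_regular : regular_graph e k.

Lemma f_cell (o a : V) : exists i, f o a = x i.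
Proof.
have [_ /(_ (f o a)) [h _]] := f_range.
by have [i <-] := h (ex_intro _ o (ex_intro _ a erefl)); exists i.
Qed.

Lemma f_eq0 (o a : V) : (f o a == x ord0) = (a == o).
Proof.
by case: e_equitable => /(_ o) /setP /(_ a); rewrite !inE.
Qed.

Lemma sum_nbrs (y : X -> R) (o a : V) (j : 'I_r.+1) : f o a = x j ->
  \sum_(w in nbrs e a) y (f o w) = \sum_i y (x i) * (Q i j)%:R.
Proof.
move=> fj; have [x_inj _] := f_range.
(* Each summand becomes a sum over its single class index, so that exchanging the sums groups the
   neighbours by class. *)
have fcase w : \sum_(i | f o w == x i) y (x i) = y (f o w).
  have [i ->] := f_cell o w.
  by rewrite (big_pred1 i) // => l /=; rewrite (inj_eq x_inj) eq_sym.
rewrite -(eq_bigr _ (fun w _ => fcase w)) (exchange_big_dep predT) //=.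
apply: eq_bigr => i _.
rewrite sumr_const mulr_natr; congr (_ *+ _).
rewrite (Q_quotient (o := o) i (v := a)) ?inE ?fj //.
by apply: eq_card => w; rewrite unfold_in /= !inE.
Qed.

(** As [y] vanishes at [x ord0], deleting row and column zero of [Q] loses nothing from the
    neighbour sum. *)
Lemma row_mul_Qminus (y : X -> R) (o a : V) (j : 'I_r) :
  y (x ord0) = 0 -> f o a = x (lift ord0 j) ->
  ((\row_(i < r) y (x (lift ord0 i))) *m (k%:R^-1 *: Qminus R Q - 1%:M)) 0 j =
  k%:R^-1 * \sum_(w in nbrs e a) y (f o w) - y (f o a).
Proof.
move=> y0 fj; rewrite mulmxBr mulmx1 -scalemxAr (sum_nbrs _ fj) !mxE fj.
rewrite [in RHS]big_ord_recl y0 mul0r add0r; congr (_ * _ - _).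
by apply: eq_bigr => i _; rewrite !mxE.
Qed.

Lemma Qminus_unit : k%:R^-1 *: Qminus R Q - 1%:M \in unitmx.
Proof.
have [x_inj x_range] := f_range.
rewrite -row_free_unit; apply: inj_row_free => c c0.
(* A left inverse of [x]; the default [ord0] serves only values outside the image of [x]. *)
pose idx t := odflt ord0 [pick i | x i == t].
have idxK i : idx (x i) = i.
  rewrite /idx; case: pickP => [l /eqP /x_inj //|/(_ i)]; by rewrite eqxx.
(* The kernel vector [c], extended by zero to the class of the centre. *)
pose y t := if unlift ord0 (idx t) is Some i then c 0 i else 0.
have y0 : y (x ord0) = 0 by rewrite /y idxK unlift_none.
have yS i : y (x (lift ord0 i)) = c 0 i by rewrite /y idxK liftK.
have cE : c = \row_(i < r) y (x (lift ord0 i)).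
  by apply/rowP => i; rewrite mxE yS.
have yh o a : y (f o a) = 0.
  move: a; apply: (harmonic_eq0 e_connected e_regular (o := o)).
    by have /eqP -> : f o o == x ord0 by rewrite f_eq0.
  move=> a ao; have [i fi] := f_cell o a.
  case: (unliftP ord0 i) fi => [j|] -> fi; last by rewrite -f_eq0 fi eqxx in ao.
  have := row_mul_Qminus y0 fi; rewrite -cE c0 mxE => /esym/eqP.
  by rewrite subr_eq0 => /eqP.
apply/rowP => i; rewrite -yS mxE.
(* Every class is attained by some pair, so [yh] reaches each entry of [c]. *)
have [_ /(_ (ex_intro _ _ erefl))] := x_range (x (lift ord0 i)).
by case=> o [a <-].
Qed.

Lemma sum_nbrs_solution (h : X -> R) (o a : V) :
  h (x ord0) = 0 ->
  \row_(i < r) h (x (lift ord0 i)) =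
    - (const_mx 1 *m invmx (k%:R^-1 *: Qminus R Q - 1%:M)) ->
  a != o -> k%:R^-1 * \sum_(w in nbrs e a) h (f o w) = h (f o a) - 1.
Proof.
move=> h0 hE ao; have [i fi] := f_cell o a.
case: (unliftP ord0 i) fi => [j|] -> fi; last by rewrite -f_eq0 fi eqxx in ao.
have := row_mul_Qminus h0 fi.
rewrite hE mulNmx -mulmxA mulVmx ?Qminus_unit // mulmx1 !mxE => /eqP.
by rewrite eq_sym subr_eq addrC => /eqP.
Qed.

End Quotient.

Lemma sum_fine_fibers (R : realType) (d : measure_display)
    (Omega : measurableType d) (P : probability Omega R) (T : finType)
    (S : Omega -> T) (A : set Omega) :
  measurable A -> (forall t, measurable (A `&` [set om | S om = t])) ->
  fine (P A) = \sum_t fine (P (A `&` [set om | S om = t])).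
Proof.
move=> mA mS.
pose B (s : seq T) := A `&` [set om | S om \in s].
(* Additivity is proved one value at a time over duplicate-free lists; measurability of [B s] is
   carried along for the disjoint union. *)
suff sumB (s : seq T) : uniq s -> measurable (B s) /\
    fine (P (B s)) = \sum_(t <- s) fine (P (A `&` [set om | S om = t])).
  rewrite -[RHS]big_enum /= -(sumB _ (enum_uniq T)).2.
  by congr (fine (P _)); apply/seteqP; split=> om; rewrite /B /= mem_enum; [split|case].
elim: s => [_|t s IH /= /andP[ts /IH [mB sB]]].
  have -> : B [::] = set0 by apply/seteqP; split=> om // -[_] /=.
  by rewrite measure0 big_nil.
have -> : B (t :: s) = (A `&` [set om | S om = t]) `|` B s.
  apply/seteqP; split=> om /=; rewrite /B /= inE.
    by move=> [Ao /orP[/eqP St|St]]; [left|right].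
  by move=> [[Ao ->]|[Ao ->]]; rewrite ?eqxx ?orbT.
split; first exact: measurableU.
rewrite measureU // ?fineD ?fin_num_measure ?big_cons ?sB //.
by apply/seteqP; split=> om // -[[_ /= St] [_ /=]]; rewrite St (negbTE ts).
Qed.

(** * The Markov property for events of the past *)

Section RandomWalk.
Variables (R : realType) (d : measure_display) (Omega : measurableType d).
Variables (V : finType) (P : probability Omega R) (e : rel V).
Variables (W : nat -> Omega -> V) (u : V).
Hypothesis walk : simple_random_walk P e W u.

(* [A] belongs to the sigma-algebra generated by [W 0], ..., [W n]. *)
Definition determined (n : nat) (A : set Omega) : Prop :=
  forall om om', (forall i, (i <= n)%N -> W i om = W i om') -> A om -> A om'.

Lemma measurable_step n a : measurable [set om | W n om = a].
Proof. by case: walk. Qed.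

Lemma measurable_follows n w : measurable (follows W n w).
Proof.
have -> : follows W n w = \bigcap_(i in [set i | (i <= n)%N])
    [set om | W i om = w i] by [].
by apply: bigcap_measurableType => i _; exact: measurable_step.
Qed.

(** The past as an element of a finite type, so that an event splits into finitely many path
    events. *)
Definition history n (om : Omega) : {ffun 'I_n.+1 -> V} :=
  [ffun i : 'I_n.+1 => W i om].

Lemma historyE n (t : {ffun 'I_n.+1 -> V}) :
  [set om | history n om = t] = follows W n (fun i => t (inord i)).
Proof.
apply/seteqP; split=> om /=.
  by move=> <- i ni; rewrite ffunE inordK.
by move=> h; apply/ffunP => i; rewrite ffunE h ?inord_val // -ltnS.
Qed.

(** Membership in [A] depends on the history alone, so a fibre of [history] lies inside [A] or
    misses it. *)
Lemma determined_history n A t : determined n A ->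
  A `&` [set om | history n om = t] = [set om | history n om = t] \/
  A `&` [set om | history n om = t] = set0.
Proof.
move=> dA; case: (pselect (exists2 om, A om & history n om = t)); last first.
  move=> nA; right; apply/seteqP; split=> om //= -[Ao ht].
  by apply: nA; exists om.
case=> om Ao ht; left; apply/seteqP; split=> om' /=; first by case.
move=> ht'; split => //; apply: dA Ao => i ni.
move: ht; rewrite -ht' => /ffunP /(_ (inord i)).
by rewrite !ffunE inordK.
Qed.

Lemma measurable_history n t : measurable [set om | history n om = t].
Proof. by rewrite historyE; exact: measurable_follows. Qed.

Lemma determined_history_measurable n A t : determined n A ->
  measurable (A `&` [set om | history n om = t]).
Proof.
by move=> /(determined_history t) [] ->; first exact: measurable_history.
Qed.

Lemma determined_measurable n A : determined n A -> measurable A.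
Proof.
move=> dA.
have -> : A = \bigcup_t (A `&` [set om | history n om = t]).
  apply/seteqP; split=> om; last by case=> t _ [].
  by move=> Ao; exists (history n om).
apply: fin_bigcup_measurable; first exact: finite_finset.
by move=> t _; exact: determined_history_measurable.
Qed.

(** The walk prescribes step probabilities after single paths only; summing over the histories
    inside [A] gives them after any past event ending at [a]. *)
Lemma prob_step n A a b : determined n A -> A `<=` [set om | W n om = a] ->
  e a b ->
  fine (P (A `&` [set om | W n.+1 om = b])) = fine (P A) * #|nbrs e a|%:R^-1.
Proof.
move=> dA Aa eab; have mA := determined_measurable dA.
have mAt t := determined_history_measurable t dA.
have mb := measurable_step n.+1 b.
rewrite (sum_fine_fibers P mA mAt).
rewrite (sum_fine_fibers P (S := history n) (measurableI _ _ mA mb)); last first.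
  by move=> t; rewrite setIAC; exact: measurableI.
rewrite mulr_suml; apply: eq_bigr => t _; rewrite setIAC.
have := Aa; case: (determined_history t dA) => tA; last first.
  by rewrite tA set0I measure0 mul0r.
(* A history that never occurs need not end in [a]; both sides are then zero. *)
case: (pselect (exists om, history n om = t)) => [[om ht]|nt] _; last first.
  have -> : A `&` [set om | history n om = t] = set0.
    by apply/seteqP; split=> om //= -[_ ht]; apply: nt; exists om.
  by rewrite set0I measure0 mul0r.
have [Ao _] : (A `&` [set om | history n om = t]) om by rewrite tA.
have ta : t (inord n) = a by rewrite -ht ffunE inordK ?(Aa _ Ao).
rewrite tA historyE; case: walk => _ _ -> //; last by rewrite ta.
by rewrite fineM ?fin_num_measure //= ?ta //; exact: measurable_follows.
Qed.

(** The steps to neighbours already use up all of [P A]; the neighbour [c] makes the degree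
    nonzero. *)
Lemma prob_step_nonadjacent n A a b c : determined n A ->
  A `<=` [set om | W n om = a] -> e a c -> ~~ e a b ->
  fine (P (A `&` [set om | W n.+1 om = b])) = 0.
Proof.
move=> dA Aa eac neab; have mA := determined_measurable dA.
have mAb b' : measurable (A `&` [set om | W n.+1 om = b']).
  by apply: measurableI => //; exact: measurable_step.
have := sum_fine_fibers P mA mAb.
have n0 : (#|nbrs e a|%:R : R) != 0.
  by rewrite pnatr_eq0 -lt0n; apply/card_gt0P; exists c; rewrite inE.
rewrite (bigID (mem (nbrs e a))) /=.
rewrite (eq_bigr (fun=> fine (P A) * #|nbrs e a|%:R^-1)); last first.
  by move=> b'; rewrite inE => eab; exact: prob_step.
rewrite sumr_const -[_ *+ _]mulr_natr mulfVK // => /esym.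
move=> /(canRL (addKr _)); rewrite addNr => /psumr_eq0P; apply.
  by move=> b' _; rewrite fine_ge0.
by rewrite inE.
Qed.

Lemma expect_step (g : V -> R) n A a c : determined n A ->
  A `<=` [set om | W n om = a] -> e a c ->
  \sum_b fine (P (A `&` [set om | W n.+1 om = b])) * g b =
  fine (P A) * (#|nbrs e a|%:R^-1 * \sum_(b in nbrs e a) g b).
Proof.
move=> dA Aa eac; rewrite (bigID (mem (nbrs e a))) /= [X in _ + X]big1.
  rewrite addr0 mulrA mulr_sumr; apply: eq_bigr => b; rewrite inE => eab.
  by rewrite (prob_step dA Aa eab).
by move=> b; rewrite inE => neab; rewrite (prob_step_nonadjacent dA Aa eac) ?mul0r.
Qed.

(** * Hitting time as a sum of survival indicators *)

Definition unvisited (v : V) (n : nat) : set Omega :=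
  [set om | forall i, (i <= n)%N -> W i om <> v].

Lemma determined_unvisited v n : determined n (unvisited v n).
Proof. by move=> om om' WW uv i ni; rewrite -WW //; exact: uv. Qed.

Lemma determined_unvisited_at v n a :
  determined n (unvisited v n `&` [set om | W n om = a]).
Proof.
move=> om om' WW [uv /= <-]; split; last by rewrite /= WW.
exact: determined_unvisited uv.
Qed.

Lemma unvisitedS v n b : b != v ->
  unvisited v n.+1 `&` [set om | W n.+1 om = b] =
  unvisited v n `&` [set om | W n.+1 om = b].
Proof.
move=> /eqP bv; apply/seteqP; split=> om /= [uv Wb]; split=> // i ni.
  by apply: uv; exact: leqW.
move: ni; rewrite leq_eqVlt => /orP[/eqP ->|]; first by rewrite Wb.
by rewrite ltnS => /uv.
Qed.

(** The indicators are one exactly at the times before the first visit, so their series counts those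
    times. *)
Lemma hitting_timeE v om :
  (hitting_time W v om = \sum_(n <oo) (\1_(unvisited v n) om : R)%:E)%E.
Proof.
have ge0 n : (0 <= (\1_(unvisited v n) om : R)%:E)%E by rewrite lee_fin.
have [hit|nohit] := pselect (exists n, W n om == v).
  case: (ex_minnP hit) => m /eqP Wm mmin.
  have -> : hitting_time W v om = (m%:R : R)%:E.
    apply/le_anti/andP; split; first by apply: ereal_inf_lbound; exists m.
    apply: le_ereal_inf_tmp => _ [n /eqP Wn <-].
    by rewrite lee_fin ler_nat mmin.
  rewrite (nneseries_split 0%N m) // add0n eseries0 ?adde0; last first.
    move=> i mi _; rewrite indicE memNset // => /(_ m mi); exact.
  rewrite (eq_big_nat _ _ (F2 := fun=> 1%E)); last first.
    move=> i /andP[_ im]; rewrite indicE mem_set // => j ji /eqP /mmin mj.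
    by have := leq_ltn_trans (leq_trans mj ji) im; rewrite ltnn.
  by rewrite sumEFin sumr_const_nat subn0.
have -> : hitting_time W v om = +oo%E :> \bar R.
  rewrite -ereal_inf0; congr ereal_inf; apply/seteqP; split=> // t [n Wn _].
  by apply: nohit; exists n; exact/eqP.
apply/esym/eq_infty => t.
(* A partial sum with more than [|t|] terms, all equal to one, already exceeds [t]. *)
apply: le_trans (nneseries_lim_ge (Num.bound `|t|) (fun n _ _ => ge0 n)).
rewrite (eq_big_nat _ _ (F2 := fun=> 1%E)); last first.
  move=> i _; rewrite indicE mem_set // => j _ /eqP Wj.
  by apply: nohit; exists j.
rewrite sumEFin sumr_const_nat subn0 lee_fin.
exact: le_trans (ler_norm _) (ltW (archi_boundP (normr_ge0 _))).
Qed.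

Lemma average_hitting_timeE v :
  (average_hitting_time P W v = \sum_(n <oo) P (unvisited v n))%E.
Proof.
have mun n := determined_measurable (@determined_unvisited v n).
rewrite /average_hitting_time (eq_integral _ _ (fun om _ => hitting_timeE v om)).
rewrite integral_nneseries //.
- apply: eq_eseriesr => n _; rewrite integral_indic //=.
  by rewrite setIT.
- by move=> n; apply/measurable_EFinP; exact: measurable_indic.
Qed.

(** * Decay of the potential along the walk *)

Section Potential.
Variables (v : V) (g : V -> R).
Hypothesis gv : g v = 0.
Hypothesis has_nbr : forall a, a != v -> exists b, e a b.
Hypothesis drift : forall a, a != v ->
  #|nbrs e a|%:R^-1 * \sum_(b in nbrs e a) g b = g a - 1.

Definition unvisited_prob n : R := fine (P (unvisited v n)).

(** This is E[g (W_n); T > n], expanded over the position at time [n]. *)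
Definition potential n : R :=
  \sum_a fine (P (unvisited v n `&` [set om | W n om = a])) * g a.

Lemma unvisited_at n a : unvisited v n `&` [set om | W n om = a] =
  if a == v then set0 else unvisited v n `&` [set om | W n om = a].
Proof.
case: eqP => // ->; apply/seteqP; split=> om //= -[uv Wv].
exact: (uv n (leqnn n)).
Qed.

Lemma sum_unvisited_at n :
  unvisited_prob n = \sum_a fine (P (unvisited v n `&` [set om | W n om = a])).
Proof.
apply: sum_fine_fibers.
  exact: determined_measurable (@determined_unvisited v n).
by move=> a; exact: determined_measurable (@determined_unvisited_at v n a).
Qed.

Lemma potential0 : potential 0 = g u.
Proof.
have [_ W0 _] := walk.
have mW := measurable_step 0.
rewrite /potential (bigD1 u) //= big1 ?addr0 => [|a au].
  (* A walk starting at [v] has no survivors at time 0, which agrees with [g v = 0]. *)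
  have [->|uv] := eqVneq u v; first by rewrite gv mulr0.
  suff -> : unvisited v 0 `&` [set om | W 0%N om = u] = [set om | W 0%N om = u].
    by rewrite W0 mul1r.
  apply/seteqP; split=> om /= => [[]//|Wu]; split=> // i.
  by rewrite leqn0 => /eqP ->; rewrite Wu; exact/eqP.
suff -> : P (unvisited v 0 `&` [set om | W 0%N om = a]) = 0%E by rewrite mul0r.
apply: (@subset_measure0 _ _ _ P _ (~` [set om | W 0%N om = u])).
- exact: determined_measurable (@determined_unvisited_at v 0 a).
- exact/measurableC/mW.
- by move=> om /= [_ ->]; exact/eqP.
- by have := probability_setC P (mW u); rewrite W0 subee.
Qed.

(** Splitting by the position [a] at time [n], one step replaces [g a] by its neighbour mean
    [g a - 1], so each position loses its own probability. *)
Lemma potentialS n : potential n.+1 = potential n - unvisited_prob n.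
Proof.
rewrite /potential sum_unvisited_at -sumrB.
transitivity (\sum_b \sum_a fine (P ((unvisited v n `&` [set om | W n om = a])
    `&` [set om | W n.+1 om = b])) * g b).
  apply: eq_bigr => b _; rewrite -mulr_suml.
  (* Survival to [n] and to [n.+1] differ only when the walk steps to [v], where [g] is zero. *)
  have [->|bv] := eqVneq b v; first by rewrite gv !mulr0.
  rewrite unvisitedS //; congr (_ * _).
  have mb := measurable_step n.+1 b.
  have mu := determined_measurable (@determined_unvisited v n).
  rewrite (sum_fine_fibers P (S := W n) (measurableI _ _ mu mb)).
    by apply: eq_bigr => a _; rewrite setIAC.
  by move=> a; exact: measurableI (measurableI _ _ mu mb) (measurable_step n a).
rewrite exchange_big; apply: eq_bigr => a _.
have [->|av] := eqVneq a v.
  rewrite unvisited_at eqxx measure0 !mul0r subr0.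
  by rewrite big1 // => b _; rewrite set0I measure0 mul0r.
have [c eac] := has_nbr av.
rewrite (expect_step g (@determined_unvisited_at v n a) _ eac); last by move=> om [].
by rewrite drift // mulrBr mulr1.
Qed.

Lemma unvisited_prob_ge0 n : 0 <= unvisited_prob n.
Proof. exact: fine_ge0. Qed.

(** The factor [unvisited_prob n] serves twice: being at most 1 it bounds the series, and tending to
    0 it forces the potential to 0. *)
Lemma potential_bound n :
  `|potential n| <= (\sum_a `|g a|) * unvisited_prob n.
Proof.
rewrite sum_unvisited_at mulr_sumr; apply: le_trans (ler_norm_sum _ _ _) _.
apply: ler_sum => a _; rewrite normrM ger0_norm ?fine_ge0 // mulrC.
by rewrite ler_wpM2r ?fine_ge0 // (bigD1 a) //= lerDl sumr_ge0.
Qed.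

Lemma series_unvisited_prob n : series unvisited_prob n = g u - potential n.
Proof.
rewrite /series /=; elim: n => [|n IH].
  by rewrite big_geq // potential0 subrr.
by rewrite big_nat_recr //= IH potentialS opprB addrA addrAC.
Qed.

Lemma cvg_unvisited_prob : unvisited_prob @ \oo --> 0.
Proof.
apply: cvg_series_cvg_0; apply: nondecreasing_is_cvgn.
  by apply: nondecreasing_series => n _ _; exact: unvisited_prob_ge0.
(* The partial sums are [g u - potential n], and the potential is at most the sum of the [|g a|] in
   absolute value. *)
exists (g u + \sum_a `|g a|) => _ [n _ <-].
rewrite series_unvisited_prob lerD2l.
apply: le_trans (ler_norm _) _; rewrite normrN.
apply: le_trans (potential_bound n) _.
rewrite ler_piMr ?sumr_ge0 // /unvisited_prob.
have mu := determined_measurable (@determined_unvisited v n).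
by rewrite -lee_fin fineK ?fin_num_measure // probability_le1.
Qed.

Lemma cvg_potential : potential @ \oo --> 0.
Proof.
apply/norm_cvg0P.
have cB : (\sum_a `|g a|) * unvisited_prob n @[n --> \oo] --> 0.
  rewrite -[X in _ --> X](mulr0 (\sum_a `|g a|)).
  by apply: cvgMr; exact: cvg_unvisited_prob.
apply: squeeze_cvgr (cvg_cst 0) cB.
by near=> n; rewrite normr_ge0 potential_bound.
Unshelve. all: by end_near. Qed.

Lemma average_hitting_time_potential : average_hitting_time P W v = (g u)%:E.
Proof.
rewrite average_hitting_timeE; apply/cvg_lim => //.
rewrite (_ : (fun n => _) = EFin \o (fun n => g u - potential n)).
  apply: cvg_EFin; first exact: nearW.
  rewrite -[X in _ --> X]subr0; apply: cvgB; first exact: cvg_cst.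
  exact: cvg_potential.
apply/funext => n /=; rewrite -series_unvisited_prob -sumEFin.
apply: eq_bigr => i _; rewrite fineK // fin_num_measure //.
exact: determined_measurable (@determined_unvisited v i).
Qed.

End Potential.

End RandomWalk.

(** * The average hitting time from the quotient matrix *)

Theorem theorem1p1 (R : realType) (V : finType) (e : rel V)
    (X : eqType) (r : nat) (x : 'I_r.+1 -> X) (f : V -> V -> X)
    (Q : 'M[nat]_r.+1) (k : nat) (h : X -> R)
    (e_simple : simple_graph e)
    (e_connected : connected_graph e)
    (f_range : enumerates_range f x)
    (e_equitable : f_equitable e f x)
    (Q_quotient : common_quotient_matrix e f x Q)
    (k_valency : regular_graph e k)
    (h_x0 : h (x ord0) = 0)
    (h_def : \row_(i < r) h (x (lift ord0 i)) =
       - (const_mx 1 *m invmx (k%:R^-1 *: Qminus R Q - 1%:M))) :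
  k%:R^-1 *: Qminus R Q - 1%:M \in unitmx /\
  forall (u v : V)
    (d : measure_display) (Omega : measurableType d) (P : probability Omega R)
    (W : nat -> Omega -> V),
    simple_random_walk P e W u ->
    average_hitting_time P W v = (h (f v u))%:E.
Proof.
split.
  exact: Qminus_unit e_connected f_range e_equitable Q_quotient k_valency.
move=> u v d Omega P W walk.
(* The partition is centred at the target [v], so the potential depends only on the class of the
   current vertex. *)
apply: (average_hitting_time_potential walk (g := fun a => h (f v a))).
- have [/(_ v) /setP /(_ v) + _ _] := e_equitable.
  by rewrite !inE eqxx => /eqP ->.
(* A path from [a] to [v] has a first edge, since [a] differs from [v]. *)
- move=> a av; have [p] := connectP (e_connected a v).
  case: p => [_ /= va|b p /= /andP[eab _] _]; last by exists b.
  by rewrite va eqxx in av.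
- move=> a av; rewrite k_valency.
  exact: (sum_nbrs_solution e_connected f_range e_equitable Q_quotient k_valency
    h_x0 h_def av).
Qed.
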